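(* Let $f:\mathbb{R}^n_{>0}\to\mathbb{R}^n_{>0}$ be order-preserving, homogeneous, and real analytic. The eigenspace $E(f)$ is nonempty and bounded in $(\mathbb{R}^n_{>0},d_H)$ if and only if $f$ has a unique eigenvector in $\mathbb{R}^n_{>0}$ up to scaling.
   Context: Entrywise order on $\mathbb{R}^n$. Order-preserving: $x\le y\Rightarrow f(x)\le f(y)$; homogeneous: $f(tx)=tf(x)$ for $t>0$; real analytic: each entry of $f$ is real analytic on $\mathbb{R}^n_{>0}$. $d_H(x,y)=\log\max_{i,j}\frac{y_ix_j}{x_iy_j}$ is Hilbert's projective metric; $E(f)=\{x\in\mathbb{R}^n_{>0}:f(x)=\mu x\text{ for some }\mu\}$. *)

(* Defs.v *)
From HB Require Import structures.
From mathcomp Require Import all_boot all_order all_algebra.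
From mathcomp Require Import all_classical all_reals all_analysis.
Set Implicit Arguments. Unset Strict Implicit. Unset Printing Implicit Defensive.
Import Order.TTheory GRing.Theory Num.Theory.
Import numFieldNormedType.Exports.
Local Open Scope classical_set_scope.
Local Open Scope ring_scope.

Section Defs.
Variables (R : realType) (n : nat).
Notation vec := ('I_n -> R).

Definition pos_vec (x : vec) : Prop := forall i, 0 < x i.

Definition vle (x y : vec) : Prop := forall i, x i <= y i.

Definition order_preserving (f : vec -> vec) : Prop :=
  forall x y, pos_vec x -> pos_vec y -> vle x y -> vle (f x) (f y).

Definition homogeneous (f : vec -> vec) : Prop :=
  forall (t : R) x, 0 < t -> pos_vec x -> f (fun i => t * x i) = (fun i => t * f x i).

Definition monom (x0 x : vec) (a : 'I_n -> nat) : R :=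
  \prod_(i < n) (x i - x0 i) ^+ a i.

(* Homogeneous part of degree k of the power series with coefficients c
   centred at x0: sum over multi-indices a with |a| = k. *)
Definition hpart (c : ('I_n -> nat) -> R) (x0 x : vec) (k : nat) : R :=
  \sum_(a : {ffun 'I_n -> 'I_k.+1} | (\sum_(i < n) (a i : nat) == k)%N)
     c (fun i => (a i : nat)) * monom x0 x (fun i => (a i : nat)).

Definition hpart_abs (c : ('I_n -> nat) -> R) (x0 x : vec) (k : nat) : R :=
  \sum_(a : {ffun 'I_n -> 'I_k.+1} | (\sum_(i < n) (a i : nat) == k)%N)
     `| c (fun i => (a i : nat)) * monom x0 x (fun i => (a i : nat)) |.

Definition real_analytic_on_cone (g : vec -> R) : Prop :=
  forall x0, pos_vec x0 ->
  exists (c : ('I_n -> nat) -> R) (r : R), 0 < r /\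
    forall x, (forall i, `|x i - x0 i| < r) ->
      cvgn (fun N => \sum_(k < N) hpart_abs c x0 x k) /\
      (fun N => \sum_(k < N) hpart c x0 x k) @ \oo --> g x.

Definition real_analytic (f : vec -> vec) : Prop :=
  forall j, real_analytic_on_cone (fun x => f x j).

Definition dH (x y : vec) : R :=
  ln (\big[Order.max/1]_(i < n) \big[Order.max/1]_(j < n)
        ((y i * x j) / (x i * y j))).

Definition eigvec (f : vec -> vec) (x : vec) : Prop :=
  pos_vec x /\ exists mu : R, f x = (fun i => mu * x i).

Definition eigspace (f : vec -> vec) : set vec := [set x | eigvec f x].

Definition dH_bounded (A : set vec) : Prop :=
  exists (x0 : vec) (M : R), pos_vec x0 /\ forall x, A x -> dH x0 x <= M.

Definition unique_eigvec_up_to_scaling (f : vec -> vec) : Prop :=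
  exists x, eigvec f x /\
    forall y, eigvec f y -> exists t : R, 0 < t /\ y = (fun i => t * x i).

End Defs.

(* Main.v *)
Require Import Defs.
From mathcomp Require Import all_boot all_order all_algebra.
From mathcomp Require Import all_classical all_reals all_analysis.
From mathcomp Require Import ring lra.

(* Two eigenvectors x, y have the same eigenvalue mu.  Let K and L be the sets
   of indices where y/x is minimal, resp. maximal, and suppose K and L are
   disjoint.  After rescaling, x <= y with equality exactly on K; by
   monotonicity f_k, k in K, takes the value mu x_k at every u in [x, y] (which
   agree with x on K), and by analyticity this persists when the coordinates of
   x off K are scaled up arbitrarily.  Symmetrically, f_l, l in L, takes the
   value mu x_l when the coordinates of x off L are scaled down arbitrarily.
   Hence for t >= 1 scaling x by t on L gives a sub-eigenvector, and scaling x
   by t off K a larger super-eigenvector.  Between them lies an eigenvector w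
   with w_k = x_k and w_l = t x_l, so the eigenspace is unbounded. *)

Import Order.TTheory GRing.Theory Num.Theory.
Import numFieldNormedType.Exports.
Local Open Scope classical_set_scope.
Local Open Scope ring_scope.

Set Implicit Arguments.
Unset Strict Implicit.

(** * One-variable power series that are constant to the left of the centre *)

Section PowerSeries.
Variable R : realType.
Implicit Types (a : nat -> R) (r B C h : R).

(** With the lower coefficients zero and the sum zero at [- h], the term of degree [m] is balanced
    by the tail, which is of order [h ^+ m.+1]; dividing by [h ^+ m] and taking [h] small forces
    [a m = 0]. *)
Lemma lead_coef_eq0 a r B d m : 0 < r -> 0 < d ->
  (forall N, \sum_(k < N) `|a k| * r ^+ k <= B) ->
  (forall k, (k < m)%N -> a k = 0) ->
  (forall h, 0 < h -> h < d -> h <= r ->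
     (fun N => \sum_(k < N) a k * (- h) ^+ k) @ \oo --> (0 : R)) ->
  a m = 0.
Proof.
move=> r0 d0 Bub am s0.
have B0 : 0 <= B by have := Bub 0; rewrite big_ord0.
have main h : 0 < h -> h < d -> h <= r -> `|a m| * r ^+ m * r <= h * B.
  move=> h0 hd hr.
  have qle : h / r <= 1 by rewrite ler_pdivrMr// mul1r.
  have q0 : 0 <= h / r by rewrite divr_ge0// ltW.
  have tail N : (m < N)%N ->
      `|\sum_(k < N) a k * (- h) ^+ k - a m * (- h) ^+ m| <= (h / r) ^+ m.+1 * B.
    move=> mN; rewrite (bigD1 (Ordinal mN))//= addrAC subrr add0r.
    apply: (le_trans (ler_norm_sum _ _ _)).
    apply: (@le_trans _ _ (\sum_(k < N) (h / r) ^+ m.+1 * (`|a k| * r ^+ k))); last first.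
      by rewrite -mulr_sumr ler_wpM2l// exprn_ge0.
    rewrite [leRHS](bigID (fun k : 'I_N => k != Ordinal mN))/=.
    rewrite -[leLHS]addr0 lerD//; last first.
      apply: sumr_ge0 => k _; apply: mulr_ge0; first exact: exprn_ge0.
      by apply: mulr_ge0 => //; rewrite exprn_ge0// ltW.
    apply: ler_sum => k km.
    have [klt|kge] := ltnP k m.
      by rewrite am// mul0r normr0 mul0r mulr0.
    have {}kge : (m.+1 <= k)%N.
      by rewrite ltn_neqAle kge andbT; apply: contraNneq km => mk; apply/eqP/val_inj.
    (* As [h / r <= 1], each power of it beyond [m] is at most the power [m.+1]. *)
    rewrite normrM normrX normrN (gtr0_norm h0) mulrCA ler_wpM2l//.
    have -> : h ^+ k = (h / r) ^+ k * r ^+ k.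
      by rewrite -exprMn divfK// gt_eqF.
    rewrite ler_wpM2r ?exprn_ge0 ?(ltW r0)//.
    by rewrite ler_wiXn2l.
  have lim : `|0 - a m * (- h) ^+ m| <= (h / r) ^+ m.+1 * B.
    have cv : (fun N => `|\sum_(k < N) a k * (- h) ^+ k - a m * (- h) ^+ m|) @ \oo
        --> `|0 - a m * (- h) ^+ m|.
      by apply: cvg_norm; apply: cvgB; [exact: s0|exact: cvg_cst].
    rewrite -(cvg_lim _ cv)//; apply: limr_le; first by apply/cvg_ex; eexists; exact: cv.
    by near=> N; apply: tail; near: N; exists m.+1.
  move: lim; rewrite sub0r normrN normrM normrX normrN (gtr0_norm h0) exprS.
  have -> : h / r * (h / r) ^+ m * B = (h * B / (r * r ^+ m)) * h ^+ m.
    by rewrite expr_div_n; field; rewrite expf_neq0 ?gt_eqF.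
  rewrite ler_pM2r ?exprn_gt0// ler_pdivlMr ?mulr_gt0 ?exprn_gt0//.
  by rewrite mulrA mulrAC.
apply/eqP; rewrite -normr_eq0 eq_le normr_ge0 andbT leNgt; apply/negP => am0.
set c := `|a m| * r ^+ m * r in main.
have c0 : 0 < c by rewrite !mulr_gt0 ?exprn_gt0.
(* The last entry gives [h * B < c], against [main]; the factor [B + 1] avoids division by zero, and
   [d / 2] makes [h < d] strict. *)
pose h := Num.min (d / 2) (Num.min r (c / (2 * (B + 1)))).
have B1 : 0 < 2 * (B + 1) by lra.
have h0 : 0 < h by rewrite !lt_min r0 !divr_gt0.
have hd : h < d by rewrite (@le_lt_trans _ _ (d / 2))// ?ge_min ?lexx//; lra.
have hr : h <= r by rewrite !ge_min lexx orbT.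
have hc : h <= c / (2 * (B + 1)) by rewrite !ge_min lexx !orbT.
move: hc; rewrite ler_pdivlMr// => hc.
have := main h h0 hd hr; nra.
Unshelve. all: by end_near.
Qed.

(** Subtracting [C] from the constant coefficient leaves a series that vanishes at small negative
    arguments; strong induction then kills its coefficients one by one. *)
Lemma pseries_const a r B C d (g : R -> R) : 0 < r -> 0 < d ->
  (forall N, \sum_(k < N) `|a k| * r ^+ k <= B) ->
  (forall h, `|h| <= r -> (fun N => \sum_(k < N) a k * h ^+ k) @ \oo --> g h) ->
  (forall h, 0 < h -> h < d -> h <= r -> g (- h) = C) ->
  forall h, `|h| <= r -> g h = C.
Proof.
move=> r0 d0 Bub cvg_g gC.
pose b k := a k - (k == 0)%:R * C.
have bE h N : (0 < N)%N -> \sum_(k < N) b k * h ^+ k = \sum_(k < N) a k * h ^+ k - C.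
  case: N => // N _; rewrite !big_ord_recl /b /= !expr0 !mulr1 mul1r.
  under eq_bigr do rewrite mul0r subr0.
  by ring.
have b_cvg h : `|h| <= r -> (fun N => \sum_(k < N) b k * h ^+ k) @ \oo --> g h - C.
  move=> hr; apply: (@cvg_trans _ ((fun N => \sum_(k < N) a k * h ^+ k - C) @ \oo)).
    by apply: near_eq_cvg; near=> N; rewrite bE//; near: N; exists 1%N.
  by apply: cvgB; [exact: cvg_g|exact: cvg_cst].
have b0 : forall m, b m = 0.
  apply: ltn_ind => m IH.
  apply: (@lead_coef_eq0 b r (B + `|C|) d m) => // [N|h h0 hd hr].
    case: N => [|N].
      by rewrite big_ord0 addr_ge0//; have := Bub 0; rewrite big_ord0.
    apply: le_trans (lerD (Bub N.+1) (lexx `|C|)).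
    rewrite !big_ord_recl /b /= !expr0 !mulr1 mul1r.
    under eq_bigr do rewrite mul0r subr0.
    by have := ler_normB (a 0) C; lra.
  rewrite -[X in _ --> X](subrr C) -{1}(gC h)//; apply: b_cvg.
  by rewrite normrN gtr0_norm.
move=> h hr; apply/eqP; rewrite -subr_eq0; apply/eqP.
rewrite -(cvg_lim _ (b_cvg _ hr))//.
have -> : (fun N => \sum_(k < N) b k * h ^+ k) = (fun=> 0).
  by apply/funext => N; rewrite big1// => k _; rewrite b0 mul0r.
by apply/cvg_lim => //; exact: cvg_cst.
Unshelve. all: by end_near.
Qed.

End PowerSeries.

(** * Analytic functions restricted to a line *)

Section Line.
Variables (R : realType) (n : nat).
Implicit Types (x d : 'I_n -> R) (c : ('I_n -> nat) -> R).

Definition line x d (s : R) : 'I_n -> R := fun i => x i + s * d i.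

Lemma monom_line x d h (e : 'I_n -> nat) :
  monom x (line x d h) e = monom x (line x d 1) e * h ^+ (\sum_(i < n) e i).
Proof.
rewrite /monom -prodrXr -big_split /=; apply: eq_bigr => i _.
by rewrite /line mul1r ![x i + _]addrC !addrK exprMn mulrC.
Qed.

(** Along a line the expansion becomes a power series in [h], with the homogeneous parts at [h = 1]
    as coefficients. *)
Lemma hpart_line c x d h k :
  hpart c x (line x d h) k = hpart c x (line x d 1) k * h ^+ k.
Proof.
by rewrite /hpart mulr_suml; apply: eq_bigr => e /eqP ek; rewrite monom_line ek mulrA.
Qed.

Lemma le_norm_hpart c x y k : `|hpart c x y k| <= hpart_abs c x y k.
Proof. exact: ler_norm_sum. Qed.

Lemma analytic_const_near (g : ('I_n -> R) -> R) x d C e :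
  real_analytic_on_cone g -> pos_vec x -> 0 < e ->
  (forall h, 0 < h -> h < e -> g (line x d (- h)) = C) ->
  exists2 r : R, 0 < r & forall h, `|h| <= r -> g (line x d h) = C.
Proof.
move=> g_an x0 e0 gC; have [c [r [r0 cvg_g]]] := g_an x x0.
(* [D] exceeds every [|d i|], so parameters up to [r / D] stay in the open cube of convergence; the
   1 keeps [D] positive for [d = 0]. *)
pose D := 1 + \sum_i `|d i|.
have D0 : 0 < D by rewrite ltr_pwDl// sumr_ge0.
have dD i : `|d i| < D.
  rewrite /D (bigD1 i)//=.
  have : 0 <= \sum_(j | j != i) `|d j| by rewrite sumr_ge0.
  by lra.
have p0 : 0 < r / D by rewrite divr_gt0.
have small h : `|h| <= r / D -> forall i, `|line x d h i - x i| < r.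
  move=> hr i; rewrite /line [x i + _]addrC addrK normrM.
  move: hr; rewrite ler_pdivlMr// => hr.
  have [/eqP ->|hn0] := boolP (h == 0); first by rewrite normr0 mul0r.
  apply: lt_le_trans hr; by rewrite ltr_pM2l// normr_gt0.
exists (r / D) => //.
have pn : `|r / D| <= r / D by rewrite gtr0_norm.
pose a k := hpart c x (line x d 1) k.
(* Absolute convergence at the single parameter [r / D] supplies the bound. *)
have [B Bub] : exists B, forall N, \sum_(k < N) `|a k| * (r / D) ^+ k <= B.
  have [cv _] := cvg_g _ (small _ pn).
  have /cvg_seq_bounded [B [_ /(_ (B + 1))]] := cv.
  rewrite ltrDl ltr01 => /(_ erefl) Bub; exists (B + 1) => N.
  apply: le_trans (Bub N I); apply: le_trans (ler_norm _).
  apply: ler_sum => k _; apply: le_trans (le_norm_hpart _ _ _ _).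
  by rewrite hpart_line normrM normrX (gtr0_norm p0).
apply: (@pseries_const R a (r / D) B C e (fun h => g (line x d h))) => //.
  move=> h hr; have [_] := cvg_g _ (small _ hr).
  by under eq_fun do under eq_bigr do rewrite hpart_line.
by move=> h h0 he _; exact: gC.
Qed.

(** Continuation argument: the supremum [m] of the parameters up to which [g] equals [C] cannot lie
    below [S], since constancy to the left of [m] spreads to its right. *)
Lemma analytic_const_segment (g : ('I_n -> R) -> R) x d C e S :
  real_analytic_on_cone g -> 0 < e -> 0 <= S ->
  (forall s, 0 <= s -> s <= S -> pos_vec (line x d s)) ->
  (forall s, 0 <= s -> s <= e -> g (line x d s) = C) ->
  g (line x d S) = C.
Proof.
move=> g_an e0 S0 pos gC.
have [Se|eS] := leP S e; first exact: gC.
pose A := [set s : R | s <= S /\ forall s', 0 <= s' -> s' <= s -> g (line x d s') = C].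
have Ae : A e by split => [|s' s0 s'e]; [exact: ltW|exact: gC].
have Asup : has_sup A by split; [exists e|exists S => s []].
pose m := sup A.
have em : e <= m by apply: ub_le_sup => //; case: Asup.
have mS : m <= S by apply: ge_sup; [exists e|move=> s []].
have below s : 0 <= s -> s < m -> g (line x d s) = C.
  move=> s0 sm; have ms0 : 0 < m - s by lra.
    have [s' [_ As']] := sup_adherent ms0 Asup; rewrite subKr => ss'.
  by apply: As' => //; exact: ltW.
have shift h : line (line x d m) d h = line x d (m + h).
  by apply/funext => i; rewrite /line mulrDl addrA.
have [r r0 near_m] : exists2 r : R, 0 < r &
    forall h, `|h| <= r -> g (line (line x d m) d h) = C.
  apply: (@analytic_const_near g (line x d m) d C e) => //.
    by apply: pos => //; lra.
  by move=> h h0 he; rewrite shift below//; lra.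
pose m' := Num.min S (m + r).
have Am' : A m'.
  split=> [|s s0 sm']; first by rewrite ge_min lexx.
  have [sm|ms] := ltP s m; first exact: below.
  have smr : s <= m + r by apply: le_trans sm' _; rewrite ge_min lexx orbT.
  have := near_m (s - m); rewrite shift [m + _]addrC subrK; apply.
  by rewrite ger0_norm; lra.
have : m' <= m by apply: ub_le_sup => //; case: Asup.
rewrite ge_min leNgt; case/orP => [Sm|]; last by lra.
by case: Am' => _; apply => //; rewrite le_min lexx/=; lra.
Qed.

End Line.

(** * Extremal indices, eigenvectors and eigenvalues of monotone maps *)

Section Contact.
Variables (R : realType) (n : nat).
Implicit Types x y z u v w q : 'I_n -> R.

Lemma exists_max (F : 'I_n -> R) (i0 : 'I_n) : exists i, forall j, F j <= F i.
Proof.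
by exists [arg max_(i > i0) F i]%O; case: arg_maxP => // i _ Fi j; exact: Fi.
Qed.

Lemma exists_min (F : 'I_n -> R) (i0 : 'I_n) : exists i, forall j, F i <= F j.
Proof.
by have [i Fi] := exists_max (fun j => - F j) i0; exists i => j; rewrite -lerN2.
Qed.

Lemma exists_scale (P : pred 'I_n) (F G : 'I_n -> R) :
  (forall i, P i -> 0 < G i) ->
  exists2 e, 0 < e & forall i, P i -> e * F i <= G i.
Proof.
move=> G0; have F1 i : 0 < 1 + `|F i| by rewrite ltr_pwDl.
(* The added 1 keeps the denominators positive; the default 1 covers an empty [P]. *)
exists (\big[Num.min/1]_(i | P i) (G i / (1 + `|F i|))).
  by apply: lt_bigmin => // i Pi; rewrite divr_gt0// G0.
move=> i Pi; set e := \big[_/_]_(_ | _) _.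
have : e <= G i / (1 + `|F i|) by exact: bigmin_le_cond.
have e0 : 0 < e by apply: lt_bigmin => // j Pj; rewrite divr_gt0// G0.
rewrite ler_pdivlMr//; have := ler_norm (F i); nra.
Qed.

Variable f : ('I_n -> R) -> ('I_n -> R).
Hypothesis f_mono : order_preserving f.

(* Knaster-Tarski: [w] is the supremum of the [u] in [[v, q]] with [mu u <= f u]. *)
Lemma eigvec_between v q mu :
  0 < mu -> pos_vec v -> vle v q ->
  (forall i, mu * v i <= f v i) -> (forall i, f q i <= mu * q i) ->
  exists w, [/\ vle v w, vle w q & f w = (fun i => mu * w i)].
Proof.
move=> mu0 v0 vq fv fq.
pose A := [set u | [/\ vle v u, vle u q & forall i, mu * u i <= f u i]].
pose w : 'I_n -> R := fun i => sup [set u i | u in A].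
have Av : A v by split.
have Asup i : has_sup [set u i | u in A].
  by split; [exists (v i), v|exists (q i) => _ [u [_ uq _] <-]].
have w_ub u : A u -> vle u w.
  by move=> Au i; apply: ub_le_sup; [case: (Asup i)|exists u].
have vw : vle v w by exact: w_ub.
have wq : vle w q.
  by move=> i; apply: ge_sup; [case: (Asup i)|move=> _ [u [_ uq _] <-]].
have w0 : pos_vec w by move=> i; exact: lt_le_trans (vw i).
have fw i : mu * w i <= f w i.
  rewrite mulrC -ler_pdivlMr//; apply: ge_sup; first by case: (Asup i).
  move=> _ [u Au <-]; rewrite ler_pdivlMr// mulrC.
  case: (Au) => vu _ fu; apply: le_trans (fu i) _; apply: f_mono => //.
    by move=> j; exact: lt_le_trans (vu j).
  exact: w_ub.
exists w; split=> //; apply/funext => i; apply/eqP; rewrite eq_le fw andbT.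
(* By monotonicity [u] lies in [A] as well, so [u <= w], the missing inequality. *)
pose u : 'I_n -> R := fun i => f w i / mu.
have wu : vle w u by move=> j; rewrite /u ler_pdivlMr// mulrC.
rewrite mulrC -ler_pdivrMr//; apply: (w_ub u); split.
- by move=> j; apply: le_trans (vw j) (wu j).
- move=> j; rewrite /u ler_pdivrMr// mulrC; apply: le_trans (fq j).
  by apply: f_mono => // k; exact: lt_le_trans (w0 k) (wq k).
- move=> j; rewrite /u mulrC divfK ?gt_eqF//; apply: f_mono => // k.
  exact: lt_le_trans (w0 k) (wu k).
Qed.

Hypothesis f_hom : homogeneous f.

(** The smallest multiple of [y] above [x] touches [x] at some index, and monotonicity is read off
    there. *)
Lemma eigval_le x y mu la (i0 : 'I_n) : pos_vec x -> pos_vec y ->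
  f x = (fun i => mu * x i) -> f y = (fun i => la * y i) -> mu <= la.
Proof.
move=> x0 y0 fx fy; have [i xi] := exists_max (fun i => x i / y i) i0.
pose c := x i / y i; have c0 : 0 < c by rewrite divr_gt0.
have cy0 : pos_vec (fun j => c * y j) by move=> j; rewrite mulr_gt0.
have xcy : vle x (fun j => c * y j) by move=> j; rewrite -ler_pdivrMr//; exact: xi.
have := f_mono x0 cy0 xcy i; rewrite f_hom// fx fy.
by rewrite mulrCA /c divfK ?gt_eqF// ler_pM2r.
Qed.

(** * Analyticity and the contact sets of two eigenvectors *)

Hypothesis f_an : real_analytic f.

(* Between [x] and [y] monotonicity forces [f _ k] to be constant; this holds on an
   initial piece of the segment from [x], hence by analyticity on all of it. *)
Lemma const_off_contact1 x y mu t k : pos_vec x -> pos_vec y ->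
  f x = (fun i => mu * x i) -> f y = (fun i => mu * y i) -> x k = y k ->
  (vle x y /\ 1 <= t) \/ (vle y x /\ 0 < t <= 1) ->
  f (fun i => if x i == y i then x i else t * x i) k = mu * x k.
Proof.
move=> x0 y0 fx fy xyk xyt.
pose d i := if x i == y i then 0 else (t - 1) * x i.
have -> : (fun i => if x i == y i then x i else t * x i) = line x d 1.
  by apply/funext => i; rewrite /line /d; case: ifP => _; ring.
have t0 : 0 < t by case: xyt => [[_ ?]|[_ /andP[? _]]] //; lra.
have pos s : 0 <= s -> s <= 1 -> pos_vec (line x d s).
  move=> s0 s1 i; rewrite /line /d; case: ifP => _; first by rewrite mulr0 addr0.
  have -> : x i + s * ((t - 1) * x i) = (1 + s * (t - 1)) * x i by ring.
  by rewrite mulr_gt0//; nra.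
(* For parameters up to [e] the segment does not pass beyond [y] in any coordinate. *)
have [e e0 ed] : exists2 e, 0 < e &
    forall i, x i != y i -> e * `|d i| <= `|y i - x i|.
  by apply: exists_scale => i xyi; rewrite normr_gt0 subr_eq0 eq_sym.
pose e' := Num.min e 1.
have e'0 : 0 < e' by rewrite lt_min e0 ltr01.
have fxk : f x k = mu * x k by rewrite fx.
have fyk : f y k = mu * x k by rewrite fy xyk.
apply: (@analytic_const_segment R n (fun z => f z k) x d _ e' 1) => //.
move=> s s0; rewrite le_min => /andP[se s1]; apply/eqP; rewrite eq_le.
have sd i : x i != y i -> s * `|d i| <= `|y i - x i|.
  by move=> /ed; apply: le_trans; rewrite ler_wpM2r.
have lp := pos s s0 s1.
case: xyt => [[xy t1]|[yx /andP[_ t1]]].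
- rewrite -{1}fyk -fxk; apply/andP; split; apply: f_mono => // i; rewrite /line.
    have := sd i; rewrite /d; case: eqP => [->|_]; first by rewrite mulr0 addr0.
    move=> /(_ isT); have := xy i => xyi; have := x0 i => xi0.
    rewrite ger0_norm ?mulr_ge0 ?subr_ge0 ?(ltW xi0)//.
    by rewrite ger0_norm ?subr_ge0//; lra.
  rewrite lerDl mulr_ge0// /d; case: eqP => // _.
  by rewrite mulr_ge0 ?subr_ge0// ltW.
- rewrite -{1}fxk -fyk; apply/andP; split; apply: f_mono => // i; rewrite /line.
    rewrite gerDl mulr_ge0_le0// /d; case: eqP => // _.
    by rewrite mulr_le0_ge0 ?subr_le0// ltW.
  have := sd i; rewrite /d; case: eqP => [->|_]; first by rewrite mulr0 addr0.
  move=> /(_ isT); have := yx i => yxi; have := x0 i => xi0.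
  rewrite ler0_norm ?mulr_le0_ge0 ?subr_le0 ?(ltW xi0)//.
  by rewrite ler0_norm ?subr_le0//; lra.
Qed.

(** By homogeneity [y / a] is again an eigenvector for [mu], and it agrees with [x] exactly on the
    contact set, which reduces to [a = 1]. *)
Lemma const_off_contact x y mu a t k : pos_vec x -> pos_vec y -> 0 < a ->
  f x = (fun i => mu * x i) -> f y = (fun i => mu * y i) -> y k = a * x k ->
  ((forall i, a * x i <= y i) /\ 1 <= t) \/
  ((forall i, y i <= a * x i) /\ 0 < t <= 1) ->
  f (fun i => if y i == a * x i then x i else t * x i) k = mu * x k.
Proof.
move=> x0 y0 a0 fx fy yk xyt.
have ia0 : 0 < a^-1 by rewrite invr_gt0.
have an0 : a != 0 by rewrite gt_eqF.
have -> : (fun i => if y i == a * x i then x i else t * x i) =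
          (fun i => if x i == a^-1 * y i then x i else t * x i).
  apply/funext => i; congr (if _ then _ else _).
  by apply/eqP/eqP => ->; rewrite ?mulKf ?mulVKf.
apply: const_off_contact1 => //.
- by move=> i; rewrite mulr_gt0.
- by rewrite f_hom// fy; apply/funext => i; rewrite mulrCA.
- by rewrite yk mulKf.
- case: xyt => -[xy tt]; [left|right]; split=> // i.
    by rewrite mulrC ler_pdivlMr// mulrC.
  by rewrite mulrC ler_pdivrMr// mulrC.
Qed.

(* Scale [x] by [t] where [y / x] is maximal, or everywhere except where [y / x]
   is minimal: these are a sub- and a super-eigenvector. *)
Lemma stretched_eigvec x y mu a b t k l : pos_vec x -> pos_vec y ->
  0 < mu -> 0 < a -> a < b ->
  f x = (fun i => mu * x i) -> f y = (fun i => mu * y i) ->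
  (forall i, a * x i <= y i) -> y k = a * x k ->
  (forall i, y i <= b * x i) -> y l = b * x l -> 1 <= t ->
  exists w, [/\ eigvec f w, w k = x k & w l = t * x l].
Proof.
move=> x0 y0 mu0 a0 ab fx fy ay yk yb yl t1.
have b0 := lt_trans a0 ab; have t0 : 0 < t by lra.
have disj i : y i = a * x i -> (y i == b * x i) = false.
  by move=> ->; apply/eqP => /(mulIf (lt0r_neq0 (x0 i))) abE; move: ab; rewrite abE ltxx.
pose v i := if y i == b * x i then t * x i else x i.
pose q i := if y i == a * x i then x i else t * x i.
have xt i : x i <= t * x i by rewrite ler_peMl// ltW.
have tx0 : pos_vec (fun i => t * x i) by move=> i; rewrite mulr_gt0.
have xv : vle x v by move=> i; rewrite /v; case: ifP.
have qt : vle q (fun i => t * x i) by move=> i; rewrite /q; case: ifP.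
have v0 : pos_vec v by move=> i; exact: lt_le_trans (xv i).
have vq : vle v q.
  move=> i; rewrite /v /q; case: (y i =P a * x i) => [/disj ->//|_].
  by case: ifP.
have q0 : pos_vec q by move=> i; exact: lt_le_trans (vq i).
have fv i : mu * v i <= f v i.
  rewrite {1}/v; case: eqP => [yi|_]; last first.
    by have := f_mono x0 v0 xv i; rewrite fx.
  (* Stretching on the maximal set is shrinking off it by [t^-1 <= 1], followed by a global
     scaling. *)
  have vE : v = (fun j => t * (if y j == b * x j then x j else t^-1 * x j)).
    by apply/funext => j; rewrite /v; case: ifP => // _; rewrite mulVKf ?gt_eqF.
  rewrite vE f_hom//; last first.
    by move=> j; case: ifP => // _; rewrite mulr_gt0 ?invr_gt0.
  rewrite (@const_off_contact x y mu b)// 1?mulrCA//.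
  by right; split=> //; rewrite invr_gt0 t0 invf_le1.
have fq i : f q i <= mu * q i.
  rewrite {2}/q; case: eqP => [yi|_].
    by rewrite (@const_off_contact x y mu a)//; left.
  by apply: le_trans (f_mono q0 tx0 qt i) _; rewrite f_hom// fx mulrCA.
have [w [vw wq fw]] := eigvec_between mu0 v0 vq fv fq.
exists w; split.
- split; last by exists mu.
  by move=> i; exact: lt_le_trans (vw i).
- apply/eqP; rewrite eq_le; apply/andP; split.
    by have := wq k; rewrite /q yk eqxx.
  by have := vw k; rewrite /v disj.
- apply/eqP; rewrite eq_le; apply/andP; split.
    exact: le_trans (wq l) (qt l).
  by have := vw l; rewrite /v yl eqxx.
Qed.

(** * Estimates for Hilbert's metric *)

Lemma ln_le_dH z w k l : pos_vec z -> pos_vec w ->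
  ln ((w l * z k) / (z l * w k)) <= dH z w.
Proof.
move=> z0 w0; rewrite /dH ler_ln ?posrE ?divr_gt0 ?mulr_gt0//.
  apply: le_trans (le_bigmax _ _ l); exact: le_bigmax.
apply: lt_le_trans (le_bigmax _ _ l).
by apply: lt_le_trans (le_bigmax _ _ k); rewrite divr_gt0 ?mulr_gt0.
Qed.

Lemma dH_scale x t : 0 < t -> pos_vec x -> dH x (fun i => t * x i) = 0.
Proof.
move=> t0 x0; rewrite /dH big1_idem ?ln1//=; first by rewrite maxxx.
move=> i _; rewrite big1_idem//=; first by rewrite maxxx.
move=> j _.
have -> : t * x i * x j / (x i * (t * x j)) = 1.
  by field; rewrite !gt_eqF.
by [].
Qed.

End Contact.

(** * Boundedness of the eigenspace versus uniqueness of the eigenvector *)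

Theorem theorem5p1 (R : realType) (n : nat) (f : ('I_n -> R) -> ('I_n -> R)) :
  (forall x, pos_vec x -> pos_vec (f x)) ->
  order_preserving f -> homogeneous f -> real_analytic f ->
  ((eigspace f !=set0)%classic /\ dH_bounded (eigspace f)) <->
  unique_eigvec_up_to_scaling f.
Proof.
move=> f_pos f_mono f_hom f_an; split=> [[[x [x0 [mu fx]]] [z [M [z0 zM]]]]|]; last first.
  move=> [x [[x0 fx] x_uniq]]; split; first by exists x.
  by exists x, 0; split=> // y /x_uniq[t [t0 ->]]; rewrite dH_scale.
exists x; split=> [|y [y0 [la fy]]]; first by split=> //; exists mu.
(* For [n = 0] all vectors coincide. *)
have [[i0 _]|noi] := pselect (exists i : 'I_n, True); last first.
  by exists 1; split=> //; apply/funext => i; exfalso; apply: noi; exists i.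
have muE : mu = la.
  apply/eqP; rewrite eq_le (eigval_le f_mono f_hom i0 x0 y0 fx fy).
  by rewrite (eigval_le f_mono f_hom i0 y0 x0 fy fx).
have mu0 : 0 < mu by have := f_pos x x0 i0; rewrite fx pmulr_lgt0.
subst la.
have [k ky] := exists_min (fun i => y i / x i) i0.
have [l ly] := exists_max (fun i => y i / x i) i0.
pose a := y k / x k; pose b := y l / x l.
have ay i : a * x i <= y i by rewrite -ler_pdivlMr//; exact: ky.
have yb i : y i <= b * x i by rewrite -ler_pdivrMr//; exact: ly.
have a0 : 0 < a by rewrite divr_gt0.
(* If the extreme ratios agree, [y = a x]; otherwise the eigenspace is shown to be unbounded. *)
have := ky l; rewrite le_eqVlt => /orP[/eqP ab|ab].
  exists a; split=> //; apply/funext => i; apply/eqP.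
  by rewrite eq_le ay andbT /a ab; exact: yb.
pose c := x l * z k / (z l * x k).
have c0 : 0 < c by rewrite divr_gt0 ?mulr_gt0.
(* The stretched [w] has ratio [t * c] against [z] at [k], [l], so this [t] puts it at distance at
   least [M + 1]. *)
pose t := Num.max 1 (expR (M + 1) / c).
have t1 : 1 <= t by rewrite le_max lexx.
have t0 : 0 < t := lt_le_trans ltr01 t1.
have yk : y k = a * x k by rewrite /a divfK ?gt_eqF.
have yl : y l = b * x l by rewrite /b divfK ?gt_eqF.
have [w [[w0 fw] wk wl]] :=
  stretched_eigvec f_mono f_hom f_an x0 y0 mu0 a0 ab fx fy ay yk yb yl t1.
have := zM w (conj w0 fw); have := ln_le_dH k l z0 w0; rewrite wk wl => /le_trans h /h.
have -> : t * x l * z k / (z l * x k) = t * c by rewrite /c !mulrA.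
rewrite leNgt => /negP[]; apply: (@lt_le_trans _ _ (M + 1)); first by rewrite ltrDl.
rewrite -{1}(expRK (M + 1)) ler_ln ?posrE ?expR_gt0 ?(mulr_gt0 t0 c0)//.
by rewrite -ler_pdivrMr// le_max lexx orbT.
Qed.
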